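(* Let $n,\lambda\ge2$ be even integers, $m=1+\frac{\lambda}{2}$, $\sigma>0$, $b_0>0$ and $0<\delta<\frac{b_0}{2(m+1)}$. Let $\rho$, $c_0$, $c_1$, $k$ and the function $MN:[c_0,\infty)\to(0,\infty)$ be as defined in the context. If $\lambda-n-1<0$ and $k<0$, then the optimal choice of $c\in[c_0,\infty)$ is the value $c^*\in[c_1,\infty)$ which minimizes $MN$ on $[c_1,\infty)$; that is, a minimizer $c^*$ of $MN$ on $[c_1,\infty)$ exists, and any such $c^*$ minimizes $MN$ over $[c_0,\infty)$.
   Context: The constant $\rho$ is: $\rho=1+\frac{s}{2m+3}$ with $s=\lceil\frac{n-\lambda-3}{2}\rceil$ if $n-\lambda>3$; $\rho=1$ if $n-\lambda\le3$. $c_0:=24\rho(m+1)\delta$, $c_1:=12\rho b_0$, $k:=\frac{\sigma}{2}+\frac{\ln\frac23}{24\rho\delta}$. The MN function (for band-limited functions in $B_\sigma$, with $b_0$ fixed) is $$MN(c)=\begin{cases}\sqrt{8\rho}\,c^{\frac{\lambda-n-1}{4}}e^{c\left[\frac{\sigma}{2}+\frac{\ln\frac23}{24\rho\delta}\right]} & c_0\le c\le c_1,\\[1ex] \sqrt{\frac{2}{3b_0}}\,c^{\frac{1+\lambda-n}{4}}e^{\frac{c\sigma}{2}}\left(\frac23\right)^{\frac{b_0}{2\delta}} & c_1\le c<\infty.\end{cases}$$ The two formulas agree at $c=c_1$. A value of $c\in[c_0,\infty)$ is called optimal if it minimizes $MN$ over $[c_0,\infty)$. *)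

(* Defs.v *)
From Stdlib Require Import Reals ZArith.
From Stdlib Require Export Zfloor.
Open Scope R_scope.

Definition MN_s (n lambda : Z) : Z := Zceil (IZR (n - lambda - 3) / 2).

Definition MN_rho (n lambda m : Z) : R :=
  if Z_gt_dec (n - lambda) 3
  then 1 + IZR (MN_s n lambda) / IZR (2 * m + 3)
  else 1.

Definition MN_c0 (n lambda m : Z) (delta : R) : R :=
  24 * MN_rho n lambda m * IZR (m + 1) * delta.

Definition MN_c1 (n lambda m : Z) (b0 : R) : R :=
  12 * MN_rho n lambda m * b0.

Definition MN_k (n lambda m : Z) (sigma delta : R) : R :=
  sigma / 2 + ln (2 / 3) / (24 * MN_rho n lambda m * delta).

(* The two formulas agree at [MN_c1], so assigning [MN_c1] to the first one is
   harmless.  Values at [c < MN_c0] lie outside the domain of the MN function and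
   carry no meaning; every use below restricts to a subset of [MN_c0, +oo). *)
Definition MN (n lambda m : Z) (sigma b0 delta c : R) : R :=
  if Rle_dec c (MN_c1 n lambda m b0)
  then sqrt (8 * MN_rho n lambda m) * Rpower c (IZR (lambda - n - 1) / 4)
       * exp (c * (sigma / 2 + ln (2 / 3) / (24 * MN_rho n lambda m * delta)))
  else sqrt (2 / (3 * b0)) * Rpower c (IZR (1 + lambda - n) / 4)
       * exp (c * sigma / 2) * Rpower (2 / 3) (b0 / (2 * delta)).

Definition minimizes_from (f : R -> R) (a x : R) : Prop :=
  a <= x /\ forall y : R, a <= y -> f x <= f y.

(* Main.v *)
(** On [c1, oo) the logarithm of MN is [p ln c + c sigma / 2] up to a constant, with
    [p = (1 + lambda - n) / 4]. It is increasing if [p >= 0] and convex with critical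
    point [-2p / sigma] if [p < 0], so the maximum of [c1] and [-2p / sigma] is a minimizer
    in both cases. On [c0, c1] both the power and the exponential in the first formula
    decrease, so MN is there at least [MN c1], and [c1] belongs to [c1, oo). *)
Require Import Defs.
From Stdlib Require Import Reals ZArith Lra Lia.
Open Scope R_scope.

Lemma exp_le_compat (x y : R) : x <= y -> exp x <= exp y.
Proof.
  intros [Hlt | ->]; [left; now apply exp_increasing | right; reflexivity].
Qed.

Lemma ln_le_compat (x y : R) : 0 < x -> x <= y -> ln x <= ln y.
Proof.
  intros Hx [Hlt | ->]; [left; now apply ln_increasing | right; reflexivity].
Qed.

(** Concavity of the logarithm: its graph lies below the tangent at [x]. This is [1 + t <= exp t] at
    [t = ln (y / x)]. *)
Lemma ln_le_tangent (x y : R) : 0 < x -> 0 < y -> ln y <= ln x + (y - x) / x.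
Proof.
  intros Hx Hy.
  assert (Hyx : 0 < y / x) by now apply Rdiv_lt_0_compat.
  pose proof (exp_ineq1_le (ln (y / x))) as H.
  rewrite exp_ln in H by assumption.
  unfold Rdiv in H at 1.
  rewrite ln_mult, ln_Rinv in H by (try apply Rinv_0_lt_compat; assumption).
  replace ((y - x) / x) with (y / x - 1) by (field; lra).
  lra.
Qed.

Lemma log_plus_linear_minimizer (a p r : R) :
  0 < a -> 0 < r ->
  minimizes_from (fun c => p * ln c + r * c) a (Rmax a (- p / r)).
Proof.
  intros Ha Hr.
  pose proof (Rmax_l a (- p / r)) as Hxa.
  pose proof (Rmax_r a (- p / r)) as Hxp.
  assert (Hx : Rmax a (- p / r) = a \/ Rmax a (- p / r) = - p / r)
    by (unfold Rmax; destruct (Rle_dec a (- p / r)); auto).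
  set (x := Rmax a (- p / r)) in *; clearbody x.
  split; [assumption | intros y Hy].
  destruct (Rle_dec 0 p) as [Hp | Hp].
  (* Here [- p / r <= 0 < a], so the maximum [x] is [a] and lies below [y]. *)
  - assert (Hpr : - p / r <= 0).
    { assert (0 <= p / r) by (apply Rle_mult_inv_pos; lra).
      unfold Rdiv in *; lra. }
    assert (Hxy : x <= y) by lra.
    assert (Hln : ln x <= ln y) by (apply ln_le_compat; lra).
    nra.
  - pose proof (ln_le_tangent x y ltac:(lra) ltac:(lra)) as Ht.
    (* First-order optimality condition: [p / x + r] is the derivative at [x]. It vanishes at
       [- p / r]; at [x = a >= - p / r] it is nonnegative, and so is [y - a]. *)
    assert (Hslope : 0 <= (y - x) * (p / x + r)).
    { assert (Hs : p / x + r = (x - - p / r) * (r / x)) by (field; lra).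
      rewrite Hs.
      assert (Hrx : 0 < r / x) by (apply Rdiv_lt_0_compat; lra).
      destruct Hx as [-> | <-].
      - apply Rmult_le_pos; [lra |].
        apply Rmult_le_pos; lra.
      - right; ring. }
    (* Since [p < 0], multiplying by [p] turns the upper tangent bound for [ln y] into a lower bound
       for [p * ln y]. *)
    assert (Hm : p * (ln x + (y - x) / x) <= p * ln y) by nra.
    replace (p * (ln x + (y - x) / x)) with (p * ln x + (y - x) * (p / x)) in Hm
      by (field; lra).
    nra.
Qed.

Lemma MN_rho_pos (n lambda m : Z) : (0 <= m)%Z -> 0 < MN_rho n lambda m.
Proof.
  intros Hm. unfold MN_rho.
  destruct (Z_gt_dec (n - lambda) 3) as [Hgt | _]; [| lra].
  assert (Hs : 0 <= IZR (MN_s n lambda)).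
  { unfold MN_s.
    pose proof (Zceil_bound (IZR (n - lambda - 3) / 2)) as Hc.
    assert (0 < IZR (n - lambda - 3)) by (apply IZR_lt; lia).
    lra. }
  assert (Hd : 0 < IZR (2 * m + 3)) by (apply IZR_lt; lia).
  assert (0 <= IZR (MN_s n lambda) / IZR (2 * m + 3))
    by (apply Rle_mult_inv_pos; assumption).
  lra.
Qed.

Lemma MN_le_c1 (n lambda m : Z) (sigma b0 delta c : R) :
  c <= MN_c1 n lambda m b0 ->
  MN n lambda m sigma b0 delta c =
  sqrt (8 * MN_rho n lambda m)
  * exp (IZR (lambda - n - 1) / 4 * ln c + c * MN_k n lambda m sigma delta).
Proof.
  intros Hc. unfold MN.
  destruct (Rle_dec c (MN_c1 n lambda m b0)) as [_ | H]; [| contradiction].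
  unfold Rpower, MN_k. rewrite exp_plus. ring.
Qed.

(** The endpoint [MN_c1] is included although [MN] evaluates it by the first formula, so a single
    expression describes [MN] on all of [c1, oo). *)
Lemma MN_ge_c1 (n lambda m : Z) (sigma b0 delta c : R) :
  0 < MN_rho n lambda m -> 0 < b0 -> delta <> 0 ->
  MN_c1 n lambda m b0 <= c ->
  MN n lambda m sigma b0 delta c =
  sqrt (2 / (3 * b0)) * Rpower (2 / 3) (b0 / (2 * delta))
  * exp (IZR (1 + lambda - n) / 4 * ln c + sigma / 2 * c).
Proof.
  intros Hrho Hb0 Hdelta [Hlt | <-].
  - unfold MN.
    destruct (Rle_dec c (MN_c1 n lambda m b0)) as [H | _]; [lra |].
    unfold Rpower. rewrite exp_plus.
    replace (c * sigma / 2) with (sigma / 2 * c) by field. ring.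
  - rewrite MN_le_c1 by lra.
    assert (Hc1 : 0 < MN_c1 n lambda m b0)
      by (unfold MN_c1; repeat apply Rmult_lt_0_compat; lra).
    (* The two formulas agree at c1: the factor [sqrt c1] split off here raises the exponent of c1
       by 1/2, from (lambda - n - 1) / 4 to (1 + lambda - n) / 4. Since c1 / (24 rho delta) = b0 /
       (2 delta), the logarithmic term of [MN_k] gives the power of 2/3. *)
    replace (8 * MN_rho n lambda m) with (2 / (3 * b0) * MN_c1 n lambda m b0)
      by (unfold MN_c1; field; lra).
    rewrite sqrt_mult_alt by (apply Rlt_le, Rdiv_lt_0_compat; lra).
    rewrite <- (Rpower_sqrt (MN_c1 n lambda m b0)) by assumption.
    unfold Rpower. rewrite !Rmult_assoc, <- !exp_plus.
    do 2 f_equal.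
    rewrite !minus_IZR, plus_IZR.
    unfold MN_k, MN_c1. field. lra.
Qed.

Lemma power_mul_exp_antitone (a p k x y : R) :
  0 <= a -> p <= 0 -> k <= 0 -> 0 < x -> x <= y ->
  a * exp (p * ln y + y * k) <= a * exp (p * ln x + x * k).
Proof.
  intros Ha Hp Hk Hx Hxy.
  apply Rmult_le_compat_l; [assumption |].
  apply exp_le_compat.
  assert (Hln : ln x <= ln y) by now apply ln_le_compat.
  nra.
Qed.

Theorem mainTheorem5 (n lambda m : Z) (sigma b0 delta : R)
  (hn : (2 <= n)%Z) (hn_even : Z.Even n)
  (hlambda : (2 <= lambda)%Z) (hlambda_even : Z.Even lambda)
  (hm : m = (1 + lambda / 2)%Z)
  (hsigma : 0 < sigma) (hb0 : 0 < b0)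
  (hdelta : 0 < delta < b0 / (2 * IZR (m + 1)))
  (hexp : (lambda - n - 1 < 0)%Z)
  (hk : MN_k n lambda m sigma delta < 0) :
  (exists cstar : R,
      minimizes_from (MN n lambda m sigma b0 delta) (MN_c1 n lambda m b0) cstar) /\
  (forall cstar : R,
      minimizes_from (MN n lambda m sigma b0 delta) (MN_c1 n lambda m b0) cstar ->
      minimizes_from (MN n lambda m sigma b0 delta) (MN_c0 n lambda m delta) cstar).
Proof.
  assert (Hm : (0 <= m)%Z)
    by (pose proof (Z.div_pos lambda 2 ltac:(lia) ltac:(lia)); lia).
  pose proof (MN_rho_pos n lambda m Hm) as Hrho.
  destruct hdelta as [Hd0 Hd].
  assert (Hm1 : 0 < IZR (m + 1)) by (apply IZR_lt; lia).
  assert (Hc0 : 0 < MN_c0 n lambda m delta)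
    by (unfold MN_c0; repeat apply Rmult_lt_0_compat; lra).
  assert (Hc1 : 0 < MN_c1 n lambda m b0)
    by (unfold MN_c1; repeat apply Rmult_lt_0_compat; lra).
  assert (Hc01 : MN_c0 n lambda m delta <= MN_c1 n lambda m b0).
  { unfold MN_c0, MN_c1.
    (* The upper bound on [delta], cleared of its denominator; multiplied by 12 rho it reads c0 <=
       c1. *)
    assert (Hmd : delta * (2 * IZR (m + 1)) <= b0).
    { apply Rlt_le. apply (Rmult_lt_compat_r (2 * IZR (m + 1))) in Hd; [| lra].
      replace (b0 / (2 * IZR (m + 1)) * (2 * IZR (m + 1))) with b0 in Hd
        by (field; lra).
      assumption. }
    nra. }
  split.
  - destruct (log_plus_linear_minimizer (MN_c1 n lambda m b0)
                (IZR (1 + lambda - n) / 4) (sigma / 2) Hc1 ltac:(lra)) as [Hx Hmin].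
    eexists; split; [exact Hx | intros y Hy].
    rewrite !MN_ge_c1 by (assumption || lra).
    apply Rmult_le_compat_l; [| now apply exp_le_compat, Hmin].
    apply Rmult_le_pos; [apply sqrt_pos | apply Rlt_le, exp_pos].
  - intros cstar [Hc Hmin].
    split; [lra | intros y Hy].
    destruct (Rle_dec (MN_c1 n lambda m b0) y) as [Hge | Hlt]; [now apply Hmin |].
    (* For [y] below c1 the comparison passes through c1: MN cstar <= MN c1 <= MN y. *)
    apply Rle_trans with (1 := Hmin _ (Rle_refl _)).
    rewrite !MN_le_c1 by lra.
    apply IZR_lt in hexp.
    apply power_mul_exp_antitone; try lra; apply sqrt_pos.
Qed.
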